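(* Let $K$ be a field and $n$ a positive integer. Then there are no periodic power maps over the matrix ring $\mathcal{M}_n(K)$; that is, for every positive integer $m$ there is no nonzero $A \in \mathcal{M}_n(K)$ such that $(X + A)^m = X^m$ for all $X \in \mathcal{M}_n(K)$.
   Context: $\mathcal{M}_n(K)$ is the ring of $n \times n$ matrices with entries in $K$. A power map over a ring $R$ is a function $R \to R$ of the form $f(x) = x^m$ for a fixed positive integer $m$. It is periodic if there is a nonzero $h \in R$ with $f(x+h) = f(x)$ for all $x \in R$. *)

(* Defs.v *)
From HB Require Import structures.
From mathcomp Require Import all_boot all_order all_algebra.

Set Implicit Arguments.
Unset Strict Implicit.
Unset Printing Implicit Defensive.

Import GRing.Theory.
Local Open Scope ring_scope.

(* [pzRingType] rather than [nzRingType]: this is the ring structure carried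
   by ['M[K]_n] for a variable size [n]. *)
Definition is_power_map (R : pzRingType) (f : R -> R) : Prop :=
  exists2 m : nat, (0 < m)%N & forall x : R, f x = x ^+ m.

Definition periodic (R : pzRingType) (f : R -> R) : Prop :=
  exists2 h : R, h <> 0 & forall x : R, f (x + h) = f x.

(* Main.v *)
Require Import Defs.
From HB Require Import structures.
From mathcomp Require Import all_boot all_order all_algebra.

Set Implicit Arguments.
Unset Strict Implicit.
Unset Printing Implicit Defensive.

Import GRing.Theory.
Local Open Scope ring_scope.

(** Suppose [A] is a nonzero period of [X |-> X ^+ m]. Evaluating at [X = 0]
    gives [A ^+ m = 0], so [A] is nilpotent, and some row vectors satisfy
    [v *m A = w], [w *m A = 0] with [w != 0] ([nilpotent_square_annihilator]).
    A rank-one matrix [X] of square zero can then be built that sends [w] back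
    to [v] and kills [v] ([square_zero_reverse]). The matrix [X + A] swaps [v]
    and [w], so none of its powers vanishes, whereas [X ^+ m = 0] as soon as
    [2 <= m]. The case [m = 1] is immediate, since then [A ^+ m = A]. *)

(** [B] is the power of [A] two below the nilpotency index, which is at least 2
    because [A] is nonzero. *)
Lemma nilpotent_square_annihilator (R : pzRingType) (A : R) (m : nat) :
  A <> 0 -> A ^+ m = 0 -> exists2 B : R, B * A <> 0 & B * A * A = 0.
Proof.
move=> A0; elim: m => [|m IHm] Am0.
  by case: A0; rewrite -[A]mulr1 -(expr0 A) Am0 mulr0.
case: (eqVneq (A ^+ m) 0) => [/IHm // | /eqP Am].
case: m Am Am0 {IHm} => [|k] Ak Ak0; first by rewrite expr1 in Ak0.
by exists (A ^+ k); rewrite -!exprSr.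
Qed.

(** No linear independence of [u] and [w] has to be established: for any column
    [p] with [w *m p = 1], subtracting from [u] the multiple [(u *m p) *m w]
    yields a [v] with the same image under [A] and with [v *m p = 0], so that
    [X = p *m v] works. *)
Lemma square_zero_reverse (K : fieldType) (n : nat) (A : 'M[K]_n)
    (u w : 'rV[K]_n) :
  w != 0 -> u *m A = w -> w *m A = 0 ->
  exists v : 'rV[K]_n, exists X : 'M[K]_n,
    [/\ v *m A = w, w *m X = v, v *m X = 0 & X *m X = 0].
Proof.
case/rV0Pn=> j wj uA wA.
pose p : 'cV[K]_n := (w 0 j)^-1 *: delta_mx j 0.
have wp : w *m p = 1%:M.
  rewrite -scalemxAr -colE; apply/matrixP=> i k.
  by rewrite !ord1 !mxE eqxx mulVf.
pose v := u - u *m p *m w.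
have vp : v *m p = 0 by rewrite mulmxBl -[_ *m w *m p]mulmxA wp mulmx1 subrr.
exists v, (p *m v); split.
- by rewrite mulmxBl uA -[_ *m w *m A]mulmxA wA mulmx0 subr0.
- by rewrite mulmxA wp mul1mx.
- by rewrite mulmxA vp mul0mx.
- by rewrite mulmxA -[p *m v *m p]mulmxA vp mulmx0 mul0mx.
Qed.

Lemma swap_expr_neq0 (K : fieldType) (n : nat) (Y : 'M[K]_n)
    (v w : 'rV[K]_n) (m : nat) :
  v != 0 -> w != 0 -> v *m Y = w -> w *m Y = v -> Y ^+ m <> 0.
Proof.
move=> v0 w0 vY wY Ym0.
suff : v *m Y ^+ m != 0 by rewrite Ym0 mulmx0 eqxx.
elim: m v w v0 w0 vY wY {Ym0} => [|m IHm] v w v0 w0 vY wY.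
  by rewrite expr0 mulmx1.
by rewrite exprS mulmxA vY (IHm w v).
Qed.

Theorem mainTheorem10 (K : fieldType) (n : nat) (n_gt0 : (0 < n)%N) :
  ~ (exists f : 'M[K]_n -> 'M[K]_n, is_power_map f /\ periodic f).
Proof.
case=> f [[m m_gt0 fE] [A A0 perA]].
have powA X : (X + A) ^+ m = X ^+ m by rewrite -!fE perA.
have Am0 : A ^+ m = 0 by rewrite -[A]add0r powA expr0n -(prednK m_gt0).
have [B BA0 BAA] := nilpotent_square_annihilator A0 Am0.
have /existsP[i w0] : [exists i, row i (B *m A) != 0].
  apply: contra_notT BA0; rewrite negb_exists => /forallP rows0.
  by apply/row_matrixP=> i; rewrite row0; apply/eqP/negPn/rows0.
have uA : row i B *m A = row i (B *m A) by rewrite row_mul.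
have wA : row i (B *m A) *m A = 0 by rewrite -row_mul [B *m A *m A]BAA row0.
have [v [X [vA wX vX XX]]] := square_zero_reverse w0 uA wA.
have v0 : v != 0 by apply: contraNneq w0 => v0; rewrite -vA v0 mul0mx.
(* For [m = 1], [A ^+ 1] is convertible to [A], contradicting [A <> 0]. *)
case: m m_gt0 powA Am0 {fE} => [|[|m]] // _ powA Am0.
apply: (swap_expr_neq0 (Y := X + A) (m := m.+2) v0 w0).
- by rewrite mulmxDr vX vA add0r.
- by rewrite mulmxDr wX wA addr0.
- by rewrite powA !exprS mulrA [X * X]XX mul0r.
Qed.
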